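(* Let $\Omega$ be a compact Hausdorff space and let $F=(f_1,f_2,\dots)\in\ell^\infty(C(\Omega))$, i.e. $F$ is a norm-bounded sequence in $C(\Omega)$. For $s\in\Omega$ put $F(s)=(f_1(s),f_2(s),\dots)\in\ell^\infty$. The following are equivalent: (1) the image set $F(\Omega)=\{F(s):s\in\Omega\}$ is totally bounded in $\ell^\infty$; (2) the sequence $F=(f_1,f_2,\dots)$ belongs to $\ell^\infty_c(C(\Omega))$; (3) the operator $\Lambda_F:\ell^1\to C(\Omega)$, $\Lambda_F(\beta)=\sum_{i=1}^\infty\beta_i f_i$, is compact; (4) the set $\{f_1,f_2,\dots\}$ is totally bounded in $C(\Omega)$; (5) the function $F:\Omega\to\ell^\infty$, $s\mapsto F(s)$, is continuous.
   Context: $C(\Omega)$ is the Banach space of continuous functions $\Omega\to\mathbb C$ with the uniform norm. $\ell^\infty_c(C(\Omega))$ is the set of all sequences $(f_1,f_2,\dots)$ in $C(\Omega)$ such that $\{(\phi(f_1),\phi(f_2),\dots):\phi\in C(\Omega)^*,\|\phi\|\le1\}$ is contained in $\ell^\infty$ and is a totally bounded subset of $\ell^\infty$. *)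

(* Defs.v *)
From HB Require Import structures.
From mathcomp Require Import all_boot all_order all_algebra lra.
From mathcomp Require Import complex.
From mathcomp Require Import all_classical all_reals all_analysis.
Import Order.TTheory GRing.Theory Num.Theory.
Import numFieldNormedType.Exports.

Set Implicit Arguments.
Unset Strict Implicit.
Unset Printing Implicit Defensive.

Local Open Scope classical_set_scope.
Local Open Scope ring_scope.
Local Open Scope complex_scope.

(* R[i] is named because the library's normed structure on numeric fields is
   inferred from the coercion of numClosedFieldType, not from the constructor
   [complex]. *)
Definition Cplx (R : realType) : numClosedFieldType := R[i].

(* Norms of normedModType (Cplx R) are Cplx R-valued; suprema and series of
   norms are taken in R. *)
Definition rnorm (R : realType) (V : normedModType (Cplx R)) (v : V) : R :=
  complex.Re (`|v| : R[i]).

Lemma addCE (R : realType) (x y : R) : (x + y)%:C = x%:C + y%:C :> Cplx R.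
Proof. exact: (rmorphD (real_complex R)). Qed.

Lemma mulCE (R : realType) (x y : R) : (x * y)%:C = x%:C * y%:C :> Cplx R.
Proof. exact: (rmorphM (real_complex R)). Qed.

Section rnorm_theory.
Variables (R : realType) (V : normedModType (Cplx R)).
Implicit Types (v w : V) (a : Cplx R).

Lemma rnormE v : `|v| = (rnorm v)%:C :> Cplx R.
Proof. by rewrite /rnorm [RHS]RRe_real //; exact: (ger0_real (normr_ge0 v)). Qed.

Lemma rnorm_leP v (r : R) : (`|v| <= r%:C :> Cplx R) = (rnorm v <= r).
Proof. by rewrite rnormE; exact: lecR. Qed.

Lemma rnorm_ge0 v : 0 <= rnorm v.
Proof. by have := normr_ge0 v; rewrite rnormE -[0]/(0%:C : R[i]) => /[!lecR]. Qed.

Lemma ler_rnormD v w : rnorm (v + w) <= rnorm v + rnorm w.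
Proof. by rewrite -rnorm_leP addCE -!rnormE; exact: ler_normD. Qed.

Lemma rnormN v : rnorm (- v) = rnorm v.
Proof. by rewrite /rnorm normrN. Qed.

Lemma rnorm0 : rnorm (0 : V) = 0.
Proof. by rewrite /rnorm normr0. Qed.

Lemma rnorm0_eq0 v : rnorm v = 0 -> v = 0.
Proof. by move=> v0; apply/normr0_eq0; rewrite rnormE v0. Qed.

Lemma rnorm_continuous : continuous (@rnorm R V).
Proof.
move=> v; apply/cvgrPdist_lt => e e0; near=> w.
have: `|v - w| < e%:C :> Cplx R.
  by near: w; apply: cvgr_dist_lt => //; rewrite -[0]/(0%:C : R[i]) ltcR.
rewrite rnormE => /[!ltcR]; apply: le_lt_trans.
have vw : rnorm v <= rnorm (v - w) + rnorm w.
  by rewrite -{1}(subrK w v) ler_rnormD.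
have wv : rnorm w <= rnorm (v - w) + rnorm v.
  by rewrite -(rnormN (v - w)) opprB -{1}(subrK v w) ler_rnormD.
by rewrite ler_norml; apply/andP; split; lra.
Unshelve. all: by end_near. Qed.

End rnorm_theory.

Lemma rnormZ (R : realType) (V : normedModType (Cplx R)) (a : Cplx R) (v : V) :
  rnorm (a *: v) = rnorm a * rnorm v.
Proof.
apply: complexI; apply: etrans (_ : (rnorm a)%:C * (rnorm v)%:C = _ :> Cplx R).
  by rewrite -!rnormE -normrZ.
by rewrite -mulCE.
Qed.

Section supnorm.
Variables (R : realType) (T : Type) (V : normedModType (Cplx R)).
Implicit Types u v : T -> V.

Definition supnorm u : R := sup (range (fun t => rnorm (u t))).

Lemma bounded_funPr u :
  bounded_fun u <-> exists M : R, forall t, rnorm (u t) <= M.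
Proof.
split=> [[M [Mr uM]]|[M uM]].
  exists (complex.Re (M + 1 : R[i])) => t.
  rewrite -rnorm_leP [X in _ <= X]RRe_real; last first.
    exact: realD Mr (real1 _).
  by apply: uM => //; rewrite ltrDl.
exists (M%:C); split.
  by apply/complex_realP; exists M.
move=> x Mx t _ /=; apply: le_trans (ltW Mx).
by rewrite rnorm_leP.
Qed.

Lemma supnorm_ubound u t : bounded_fun u -> rnorm (u t) <= supnorm u.
Proof.
move=> /bounded_funPr[M uM]; apply: sup_upper_bound; last by exists t.
by split; [exists (rnorm (u t)), t|exists M => _ [s _ <-]].
Qed.

Lemma supnorm_le u (M : R) :
  0 <= M -> (forall t, rnorm (u t) <= M) -> supnorm u <= M.
Proof.
move=> M0 uM; have [ne|/set0P ne] :=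
  eqVneq (range (fun t => rnorm (u t))) set0.
  by rewrite /supnorm ne sup0.
by apply: ge_sup => // _ [t _ <-].
Qed.

Lemma supnorm_ge0 u : bounded_fun u -> 0 <= supnorm u.
Proof.
move=> bu; have [ne|/set0P[_ [t _ _]]] :=
  eqVneq (range (fun t => rnorm (u t))) set0.
  by rewrite /supnorm ne sup0.
exact: le_trans (rnorm_ge0 _) (supnorm_ubound t bu).
Qed.

Lemma ler_supnormD u v : bounded_fun u -> bounded_fun v ->
  supnorm (u \+ v) <= supnorm u + supnorm v.
Proof.
move=> bu bv; apply: supnorm_le => [|t]; first by rewrite addr_ge0 ?supnorm_ge0.
by apply: le_trans (ler_rnormD _ _) _; rewrite lerD ?supnorm_ubound.
Qed.

Lemma bounded_funZ (a : Cplx R) u : bounded_fun u -> bounded_fun (a \*: u).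
Proof.
move=> /bounded_funPr[M uM]; apply/bounded_funPr; exists (rnorm a * M) => t.
by rewrite rnormZ ler_wpM2l ?rnorm_ge0.
Qed.

Lemma supnormZ (a : Cplx R) u : bounded_fun u ->
  supnorm (a \*: u) = rnorm a * supnorm u.
Proof.
move=> bu; apply/eqP; rewrite eq_le; apply/andP; split.
  apply: supnorm_le => [|t]; first by rewrite mulr_ge0 ?rnorm_ge0 ?supnorm_ge0.
  by rewrite rnormZ ler_wpM2l ?rnorm_ge0 ?supnorm_ubound.
have [->|an0] := eqVneq (rnorm a) 0.
  by rewrite mul0r supnorm_ge0//; exact: bounded_funZ.
have a0 : 0 < rnorm a by rewrite lt_neqAle eq_sym an0 rnorm_ge0.
rewrite mulrC -ler_pdivlMr//; apply: supnorm_le => [|t].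
  by rewrite divr_ge0 ?(ltW a0)// supnorm_ge0//; exact: bounded_funZ.
rewrite ler_pdivlMr// mulrC -rnormZ.
exact: (supnorm_ubound t (bounded_funZ a bu)).
Qed.

Lemma supnorm0_eq0 u : bounded_fun u -> supnorm u = 0 -> u = fun=> 0.
Proof.
move=> bu u0; apply/funext => t; apply/rnorm0_eq0/le_anti.
by rewrite rnorm_ge0 andbT -u0 supnorm_ubound.
Qed.

Lemma bounded_funDr u v :
  bounded_fun u -> bounded_fun v -> bounded_fun (u \+ v).
Proof.
move=> /bounded_funPr[M uM] /bounded_funPr[N vN].
apply/bounded_funPr; exists (M + N) => t.
by apply: le_trans (ler_rnormD _ _) _; rewrite lerD.
Qed.

End supnorm.

HB.mixin Record isCompactHausdorff T & Topological T := {
  compactT : compact [set: T];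
  hausdorffT : hausdorff_space T
}.

#[short(type="compactHausdorffType")]
HB.structure Definition CompactHausdorff :=
  {T of Topological T & isCompactHausdorff T}.

Section Cspace.
Variables (R : realType) (Om : compactHausdorffType).

Definition continuous_pred : {pred Om -> Cplx R} := mem [set f | continuous f].

(* The library's [continuousType] already carries a (different) topology, hence
   the separate subtype. *)
Record Cspace :=
  MkCspace { Cspace_fun :> Om -> Cplx R; _ : Cspace_fun \in continuous_pred }.

HB.instance Definition _ := [isSub for Cspace_fun].
HB.instance Definition _ := [Choice of Cspace by <:].

Lemma continuous_submod_closed : submod_closed continuous_pred.
Proof.
split=> [|a f g]; first by rewrite inE /= => x; exact: cvg_cst.
move=> /set_mem cf /set_mem cg; apply/mem_set => x.
apply: (@cvgD _ (Cplx R)); last exact: cg.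
by apply: (@cvgZl_tmp _ (Cplx R)); exact: cf.
Qed.

HB.instance Definition _ :=
  GRing.isSubmodClosed.Build _ _ continuous_pred continuous_submod_closed.
HB.instance Definition _ := [SubChoice_isSubLmodule of Cspace by <:].

Lemma Cspace_continuous (f : Cspace) : continuous f.
Proof. by case: f => f /=; rewrite inE. Qed.

Lemma Cspace_bounded (f : Cspace) : bounded_fun (f : Om -> Cplx R).
Proof.
have cn : continuous (fun s => rnorm (f s)).
  move=> s; apply: continuous_comp; first exact: Cspace_continuous.
  exact: rnorm_continuous.
have /compact_bounded[M [_ fM]] := continuous_compact
  (continuous_subspaceT cn) compactT.
apply/bounded_funPr; exists (M + 1) => t.
apply: le_trans (ler_norm _) _.
by apply: (fM (M + 1)); [rewrite ltrDl|exists t].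
Qed.

Definition Cspace_norm (f : Cspace) : Cplx R := (supnorm f)%:C.

Lemma ler_Cspace_normD f g :
  Cspace_norm (f + g) <= Cspace_norm f + Cspace_norm g.
Proof.
rewrite /Cspace_norm -addCE lecR.
exact: ler_supnormD (Cspace_bounded f) (Cspace_bounded g).
Qed.

Lemma Cspace_normZ (a : Cplx R) f :
  Cspace_norm (a *: f) = `|a| * Cspace_norm f.
Proof.
rewrite rnormE /Cspace_norm -mulCE; congr (_%:C).
exact: supnormZ (Cspace_bounded f).
Qed.

Lemma Cspace_norm0_eq0 f : Cspace_norm f = 0 -> f = 0.
Proof.
by move=> [f0]; apply/val_inj; exact: supnorm0_eq0 (Cspace_bounded f) f0.
Qed.

HB.instance Definition _ := Lmodule_isNormed.Build (Cplx R) Cspace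
  ler_Cspace_normD Cspace_normZ Cspace_norm0_eq0.

Lemma rnorm_CspaceE (f : Cspace) : rnorm f = supnorm f.
Proof. by []. Qed.

Lemma rnorm_Cspace_ge (f : Cspace) s : rnorm (f s) <= rnorm f.
Proof. exact: (supnorm_ubound s (Cspace_bounded f)). Qed.

End Cspace.

Section linfty.
Variables (R : realType) (V : normedModType (Cplx R)).

Definition bounded_pred : {pred nat -> V} :=
  mem [set u : nat -> V | bounded_fun u].

Record linfty :=
  MkLinfty { linfty_seq :> nat -> V; _ : linfty_seq \in bounded_pred }.

HB.instance Definition _ := [isSub for linfty_seq].
HB.instance Definition _ := [Choice of linfty by <:].

Lemma bounded_submod_closed : submod_closed bounded_pred.
Proof.
split=> [|a u v].
  by rewrite inE; apply/bounded_funPr; exists 0 => t /=; rewrite rnorm0.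
by rewrite !inE => bu bv; exact: bounded_funDr (bounded_funZ a bu) bv.
Qed.

HB.instance Definition _ :=
  GRing.isSubmodClosed.Build _ _ bounded_pred bounded_submod_closed.
HB.instance Definition _ := [SubChoice_isSubLmodule of linfty by <:].

Lemma linfty_bounded (u : linfty) : bounded_fun (u : nat -> V).
Proof. by case: u => u /=; rewrite inE. Qed.

Definition linfty_norm (u : linfty) : Cplx R := (supnorm u)%:C.

Lemma ler_linfty_normD u v :
  linfty_norm (u + v) <= linfty_norm u + linfty_norm v.
Proof.
rewrite /linfty_norm -addCE lecR.
exact: ler_supnormD (linfty_bounded u) (linfty_bounded v).
Qed.

Lemma linfty_normZ (a : Cplx R) u :
  linfty_norm (a *: u) = `|a| * linfty_norm u.
Proof.
rewrite rnormE /linfty_norm -mulCE; congr (_%:C).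
exact: supnormZ (linfty_bounded u).
Qed.

Lemma linfty_norm0_eq0 u : linfty_norm u = 0 -> u = 0.
Proof.
by move=> [u0]; apply/val_inj; exact: supnorm0_eq0 (linfty_bounded u) u0.
Qed.

HB.instance Definition _ := Lmodule_isNormed.Build (Cplx R) linfty
  ler_linfty_normD linfty_normZ linfty_norm0_eq0.

End linfty.

Section lone.
Variable R : realType.
Local Notation C := (Cplx R).

Definition summable_pred : {pred nat -> C} :=
  mem [set u : nat -> C | cvgn (series (fun i => rnorm (u i)))].

Record lone :=
  MkLone { lone_seq :> nat -> C; _ : lone_seq \in summable_pred }.

HB.instance Definition _ := [isSub for lone_seq].
HB.instance Definition _ := [Choice of lone by <:].

Lemma summableZ (a : C) (u : nat -> C) :
  cvgn (series (fun i => rnorm (u i))) ->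
  cvgn (series (fun i => rnorm (a *: u i))).
Proof.
move=> cu; under eq_fun do rewrite rnormZ.
exact: (@is_cvg_seriesZ _ _ (rnorm a) cu).
Qed.

Lemma summableD (u v : nat -> C) :
  cvgn (series (fun i => rnorm (u i))) ->
  cvgn (series (fun i => rnorm (v i))) ->
  cvgn (series (fun i => rnorm (u i + v i))).
Proof.
move=> cu cv; apply: (@series_le_cvg R _
  ((fun i => rnorm (u i)) \+ (fun i => rnorm (v i)))) => [i|i|i|].
- exact: rnorm_ge0.
- by rewrite /= addr_ge0 ?rnorm_ge0.
- exact: ler_rnormD.
- exact: is_cvg_seriesD.
Qed.

Lemma summable_submod_closed : submod_closed summable_pred.
Proof.
split=> [|a u v].
  rewrite inE /= (_ : series _ = cst 0); first exact: is_cvg_cst.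
  by apply/funext => n; rewrite /series /= big1// => i _; rewrite rnorm0.
move=> /set_mem cu /set_mem cv; apply/mem_set.
exact: (@summableD (a *: u) v (@summableZ a u cu) cv).
Qed.

HB.instance Definition _ :=
  GRing.isSubmodClosed.Build _ _ summable_pred summable_submod_closed.
HB.instance Definition _ := [SubChoice_isSubLmodule of lone by <:].

Lemma lone_summable (u : lone) : cvgn (series (fun i => rnorm (u i))).
Proof. by case: u => u /=; rewrite inE. Qed.

Definition lone_norm (u : lone) : C :=
  (limn (series (fun i => rnorm (u i))))%:C.

Lemma ler_lone_normD u v : lone_norm (u + v) <= lone_norm u + lone_norm v.
Proof.
have cu := @lone_summable u; have cv := @lone_summable v.
rewrite /lone_norm -addCE lecR -lim_seriesD//.
apply: lim_series_le => [||n].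
- exact: @lone_summable (u + v).
- exact: is_cvg_seriesD.
- exact: ler_rnormD.
Qed.

Lemma lone_normZ (a : C) u : lone_norm (a *: u) = `|a| * lone_norm u.
Proof.
rewrite rnormE /lone_norm -mulCE; congr (_%:C).
rewrite -[RHS](lim_seriesZ (rnorm a) (@lone_summable u)); congr (limn (series _)).
by apply/funext => i; exact: rnormZ.
Qed.

Lemma lone_norm0_eq0 u : lone_norm u = 0 -> u = 0.
Proof.
move=> [u0]; apply/val_inj/funext => i; apply/rnorm0_eq0/le_anti.
rewrite rnorm_ge0 andbT -u0.
apply: le_trans (nondecreasing_cvgn_le _ (@lone_summable u) i.+1).
  by rewrite seriesEnat /= big_nat_recr//= lerDr sumr_ge0// => j _; exact: rnorm_ge0.
by apply: nondecreasing_series => j _ _; exact: rnorm_ge0.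
Qed.

HB.instance Definition _ := Lmodule_isNormed.Build C lone
  ler_lone_normD lone_normZ lone_norm0_eq0.

End lone.

Definition totally_bounded (K : numFieldType) (X : pseudoMetricType K)
    (A : set X) : Prop :=
  forall e : K, 0 < e ->
    exists2 D : set X, finite_set D & A `<=` \bigcup_(x in D) ball x e.

Section operators.
Variable R : realType.
Local Notation C := (Cplx R).

(* The supremum is only meaningful for bounded functionals, hence the
   continuity clause in [dual_ball]. *)
Definition dual_norm (V : normedModType C) (phi : V -> C) : R :=
  sup [set rnorm (phi x) | x in [set x : V | rnorm x <= 1]].

Definition dual_ball (V : normedModType C) : set {scalar V} :=
  [set phi | continuous phi /\ dual_norm phi <= 1].

Definition linfty_c (V : normedModType C) : set (nat -> V) :=
  [set u |
    (forall phi : {scalar V}, dual_ball phi -> bounded_fun (fun i => phi (u i))) /\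
    totally_bounded [set x : linfty C |
      exists2 phi : {scalar V}, dual_ball phi & forall i, x i = phi (u i)]].

(* Relative compactness of the image of the unit ball already forces the linear
   map to be bounded. *)
Definition compact_operator (V W : normedModType C) (T : V -> W) : Prop :=
  linear T /\ precompact (T @` [set x : V | `|x| <= 1]).

End operators.

Section sequences_in_Cspace.
Variables (R : realType) (Om : compactHausdorffType).
Local Notation CO := (Cspace R Om).

Lemma eval_seq_subproof (F : linfty CO) (s : Om) :
  (fun i => F i s) \in @bounded_pred R (Cplx R).
Proof.
rewrite inE; apply/bounded_funPr.
have /bounded_funPr[M FM] := linfty_bounded F.
by exists M => i; exact: le_trans (rnorm_Cspace_ge _ _) (FM i).
Qed.

Definition eval_seq (F : linfty CO) (s : Om) : linfty (Cplx R) :=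
  MkLinfty (eval_seq_subproof F s).

(* The limit is taken for the supremum norm; the series converges absolutely
   and C(Omega) is complete, so [limn] is never used at a divergent sequence. *)
Definition Lambda (F : linfty CO) (b : lone R) : CO :=
  limn (series (fun i => b i *: F i)).

End sequences_in_Cspace.

(* Main.v *)
(* Let [a] be a bounded family of scalars indexed by [I * J]. If finitely many
   columns approximate all columns uniformly, then finitely many rows approximate
   all rows uniformly: up to a small error a row is determined by its entries in
   the finitely many chosen columns, and these range over a bounded subset of a
   finite-dimensional space. This symmetry is applied to the families [F i s],
   [phi (F i)] and [Lambda F b s], where [i] is an index, [s] a point, [phi] a
   functional of norm at most 1 and [b] a vector of the unit ball of l^1. It
   gives (1) => (4) => (2) and, with the completeness of C(Omega), (1) => (3).
   Point evaluations have norm at most 1, whence (2) => (1), and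
   [Lambda F (e_i) = F i], whence (3) => (4). A finite net in (4) makes [F]
   equicontinuous, which is (5), and (5) => (1) holds because Omega is
   compact. *)
Require Import Defs.
From HB Require Import structures.
From mathcomp Require Import all_boot all_order all_algebra lra.
From mathcomp Require Import complex finmap.
From mathcomp Require Import all_classical all_reals all_analysis.
Import Order.TTheory GRing.Theory Num.Theory.
Import numFieldNormedType.Exports.

Set Implicit Arguments.
Unset Strict Implicit.
Unset Printing Implicit Defensive.

Local Open Scope classical_set_scope.
Local Open Scope ring_scope.
Local Open Scope complex_scope.

(** * Real-valued norms, neighbourhoods and finite sums *)

Section complex_norm.
Variable R : realType.
Local Notation C := (Cplx R).
Implicit Types V W : normedModType C.

(** In the order of [R[i]], comparable numbers have equal imaginary parts, so a positive element is
    real. Every radius in [C] can thus be traded for one in [R], where [lra] applies. *)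
Lemma Cplx_gt0P (e : C) : 0 < e -> exists2 r : R, 0 < r & e = r%:C.
Proof.
move=> e0; have er : e = (complex.Re (e : R[i]))%:C.
  by rewrite [RHS]RRe_real //; exact: gtr0_real.
exists (complex.Re (e : R[i])) => //.
by move: e0; rewrite {1}er -[0]/(0%:C : R[i]) ltcR.
Qed.

Lemma real_complex_gt0 (r : R) : 0 < r -> 0 < r%:C :> C.
Proof. by move=> r0; rewrite -[0]/(0%:C : R[i]) ltcR. Qed.

Lemma ball_rnormE V (x y : V) (r : R) :
  ball x (r%:C : C) y = (rnorm (x - y) < r) :> Prop.
Proof. by rewrite -ball_normE /ball_ /= rnormE ltcR. Qed.

Lemma rnorm_distC V (v w : V) : rnorm (v - w) = rnorm (w - v).
Proof. by rewrite -opprB rnormN. Qed.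

Lemma ler_rnorm_distD V (u v w : V) :
  rnorm (v - w) <= rnorm (v - u) + rnorm (u - w).
Proof. by rewrite (le_trans _ (ler_rnormD _ _))// addrA subrK. Qed.

Lemma nbhs_rnormP V (x : V) (A : set V) :
  nbhs x A <-> exists2 r : R, 0 < r & forall y, rnorm (x - y) < r -> A y.
Proof.
split=> [/nbhs_ballP[e /= /Cplx_gt0P[r r0 ->] xA]|[r r0 xA]].
  by exists r => // y xy; apply: xA; rewrite ball_rnormE.
apply/nbhs_ballP; exists (r%:C) => /=; first exact: real_complex_gt0.
by move=> y; rewrite ball_rnormE => /xA.
Qed.

Lemma fcvg_rnormP V (F : set_system V) (x : V) : Filter F ->
  F --> x <-> forall e : R, 0 < e -> F [set y | rnorm (x - y) < e].
Proof.
move=> FF; split=> [Fx e e0|Fx A /nbhs_rnormP[r r0 xA]].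
  by apply: Fx; apply/nbhs_rnormP; exists e.
exact: filterS (Fx r r0).
Qed.

Lemma cvg_rnormP (T : Type) V (F : set_system T) (f : T -> V) (y : V) :
  Filter F -> f @ F --> y <->
    forall e : R, 0 < e -> \forall t \near F, rnorm (y - f t) < e.
Proof. by move=> FF; split=> [/fcvg_rnormP|fy]; [|apply/fcvg_rnormP]. Qed.

Lemma contraction_continuous V W (f : V -> W) :
  (forall x y, rnorm (f x - f y) <= rnorm (x - y)) -> continuous f.
Proof.
move=> fle x; apply/cvg_rnormP => e e0; apply/nbhs_rnormP; exists e => // y.
exact: le_lt_trans.
Qed.

Lemma rnorm_CplxE (z : C) : rnorm z =
  Num.sqrt (complex.Re (z : R[i]) ^+ 2 + complex.Im (z : R[i]) ^+ 2).
Proof. by case: z. Qed.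

Lemma Re_ge_rnorm (z : C) : `|complex.Re (z : R[i])| <= rnorm z.
Proof. by rewrite rnorm_CplxE -sqrtr_sqr ler_wsqrtr// lerDl sqr_ge0. Qed.

Lemma Im_ge_rnorm (z : C) : `|complex.Im (z : R[i])| <= rnorm z.
Proof. by rewrite rnorm_CplxE -sqrtr_sqr ler_wsqrtr// lerDr sqr_ge0. Qed.

Lemma rnorm_le_ReIm (z : C) :
  rnorm z <= `|complex.Re (z : R[i])| + `|complex.Im (z : R[i])|.
Proof.
rewrite rnorm_CplxE -[leRHS]ger0_norm ?addr_ge0// -sqrtr_sqr ler_wsqrtr//.
rewrite sqrrD !real_normK ?num_real// lerD2r lerDl.
by rewrite mulrn_wge0// mulr_ge0.
Qed.

Lemma rnorm_real (r : R) : rnorm (r%:C : C) = `|r|.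
Proof. by rewrite rnorm_CplxE /= expr0n /= addr0 sqrtr_sqr. Qed.

Lemma ler_rnorm_sum V (I : Type) (r : seq I) (P : pred I)
    (v : I -> V) :
  rnorm (\sum_(i <- r | P i) v i) <= \sum_(i <- r | P i) rnorm (v i).
Proof.
elim/big_ind2: _ => [|x a y b xa yb|//]; first by rewrite rnorm0.
by apply: le_trans (ler_rnormD _ _) _; rewrite lerD.
Qed.

Lemma rnorm_linfty_ge V (u : linfty V) i :
  rnorm (u i) <= rnorm u.
Proof. exact: (supnorm_ubound i (linfty_bounded u)). Qed.

Lemma rnorm_linfty_le V (u : linfty V) (M : R) :
  0 <= M -> (forall i, rnorm (u i) <= M) -> rnorm u <= M.
Proof. by move=> M0 uM; apply: supnorm_le. Qed.

Lemma sum_rnorm_lone_le (b : lone R) n :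
  \sum_(0 <= i < n) rnorm (b i) <= rnorm b.
Proof.
apply: (nondecreasing_cvgn_le _ (@lone_summable _ b) n).
by apply: nondecreasing_series => j _ _; exact: rnorm_ge0.
Qed.

(** Serves to compute [Lambda F] at a unit vector: the partial sums are constant once they include
    index [i]. *)
Lemma sum_delta V (v : nat -> V) i :
  \forall n \near \oo, \sum_(0 <= j < n) ((j == i)%:R : C) *: v j = v i.
Proof.
exists i.+1 => // n /= ni.
rewrite (bigD1_seq i) ?iota_uniq ?mem_index_iota//= eqxx scale1r big1 ?addr0//.
by move=> j /negbTE ->; rewrite scale0r.
Qed.

(** * Finite nets and their transposition *)

Lemma totally_bounded_sub V (A B : set V) :
  A `<=` B -> totally_bounded B -> totally_bounded A.
Proof.
by move=> AB tbB e /tbB[D fD BD]; exists D => //; apply: subset_trans AB BD.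
Qed.

(** The centres of a net can be moved into the range at the cost of doubling the radius. Indexing
    the net by [T] gives the form that [finite_net_transpose] takes and returns. *)
Lemma totally_bounded_rangeP V (T : Type) (g : T -> V) :
  totally_bounded (range g) <->
  forall e : R, 0 < e -> exists2 D : set T, finite_set D &
    forall t, exists2 s, D s & rnorm (g t - g s) <= e.
Proof.
split=> [tb e e0|tb e /Cplx_gt0P[r r0 ->]].
  have e20 : 0 < e / 2 by rewrite divr_gt0.
  have [D fD gD] := tb _ (real_complex_gt0 e20).
  (* [h] replaces a centre by the index of a nearby point of the range; centres sent to [None] cover
     no point of the range and are dropped. *)
  have /choice[h hP] (x : V) : exists o : option T,
      (exists2 s, o = Some s & rnorm (x - g s) < e / 2) \/
      forall t, ~ rnorm (x - g t) < e / 2.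
    have [[s xs]|nxs] := pselect (exists s, rnorm (x - g s) < e / 2).
      by exists (Some s); left; exists s.
    by exists None; right => t xt; apply: nxs; exists t.
  exists (Some @^-1` (h @` D)).
    apply: (@finite_preimage _ _ (h @` D) Some); first by move=> ? ? _ _ [].
    exact: finite_image.
  move=> t; have [x Dx] := gD (g t) (imageT g t).
  rewrite ball_rnormE => xt.
  have [[s hs xs]|/(_ t xt)//] := hP x.
  exists s; first by exists x.
  apply: le_trans (ler_rnorm_distD x _ _) _.
  by rewrite [X in X + _]rnorm_distC; move: xt xs; lra.
have r20 : 0 < r / 2 by rewrite divr_gt0.
have [D fD gD] := tb _ r20; exists (g @` D); first exact: finite_image.
move=> _ [t _ <-]; have [s Ds ts] := gD t.
exists (g s); first by exists s.
by rewrite ball_rnormE rnorm_distC; move: ts r0; lra.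
Qed.

(* The colour of [z] is the grid square of side [e / 2] containing it. *)
Lemma disc_coloring (M e : R) : 0 < e ->
  exists (T : finType) (c : C -> T), forall z w,
    rnorm z <= M -> rnorm w <= M -> c z = c w -> rnorm (z - w) <= e.
Proof.
move=> e0; have e20 : 0 < e / 2 by rewrite divr_gt0.
pose k (x : R) := Num.truncn ((x + M) / (e / 2)).
pose N := Num.truncn ((M + M) / (e / 2)).
(* [inord] sends out-of-range values to 0 and could merge colours; this bound rules that out on the
   disc. *)
have kN x : `|x| <= M -> (k x < N.+1)%N.
  rewrite ler_norml ltnS => /andP[_ xM]; apply: le_truncn.
  by rewrite ler_pM2r ?invr_gt0// lerD2r.
have kP x y : `|x| <= M -> `|y| <= M -> k x = k y -> `|x - y| <= e / 2.
  rewrite !ler_norml => /andP[Mx _] /andP[My _] kxy.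
  have x0 : 0 <= (x + M) / (e / 2) by rewrite divr_ge0 ?(ltW e20)//; lra.
  have y0 : 0 <= (y + M) / (e / 2) by rewrite divr_ge0 ?(ltW e20)//; lra.
  have /andP[] := truncn_itv x0; have /andP[] := truncn_itv y0.
  rewrite -/(k x) -/(k y) kxy -[(k y).+1%:R]natr1.
  rewrite 2!(ler_pdivlMr _ _ e20) 2!(ltr_pdivrMr _ _ e20) mulrDl mul1r.
  by move=> *; apply/andP; split; lra.
exists ('I_N.+1 * 'I_N.+1)%type.
exists (fun z : C => (inord (k (complex.Re (z : R[i]))),
                      inord (k (complex.Im (z : R[i]))))).
move=> z w zM wM [] /(congr1 val) /= + /(congr1 val) /=.
have rez := le_trans (Re_ge_rnorm z) zM.
have rew := le_trans (Re_ge_rnorm w) wM.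
have imz := le_trans (Im_ge_rnorm z) zM.
have imw := le_trans (Im_ge_rnorm w) wM.
rewrite !inordK ?kN// => /kP-/(_ rez rew) zw1 /kP-/(_ imz imw) zw2.
apply: le_trans (rnorm_le_ReIm _) _.
case: z w {zM wM rez rew imz imw} zw1 zw2 => [a b] [a' b'] /=; lra.
Qed.

(* Pigeonhole on the finitely many colours of the finitely many relevant
   coordinates. *)
Lemma finite_net_transpose (I J : Type) (a : I -> J -> C) (M : R) :
    (forall i j, rnorm (a i j) <= M) ->
    (forall e : R, 0 < e -> exists2 D : set J, finite_set D &
      forall j, exists2 j', D j' & forall i, rnorm (a i j - a i j') <= e) ->
  forall e : R, 0 < e -> exists2 D : set I, finite_set D &
    forall i, exists2 i', D i' & forall j, rnorm (a i j - a i' j) <= e.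
Proof.
move=> aM net e e0; have e30 : 0 < e / 3 by rewrite divr_gt0.
have [D fD aD] := net _ e30.
(* Induction on a list of the columns in [D]: each new column multiplies the palette by a colouring
   of the disc of radius [M]. *)
have [T [c cP]] : exists (T : finType) (c : I -> T), forall i i', c i = c i' ->
    forall j, D j -> rnorm (a i j - a i' j) <= e / 3.
  case/(@finite_seqP {classic J}): fD aD => s -> _.
  elim: s => [|j s [T [c cP]]].
    by exists unit, (fun=> tt) => ? ? _ j /=; rewrite inE.
  have [T' [c' c'P]] := disc_coloring M e30.
  exists (T * T')%type, (fun i => (c i, c' (a i j))) => i i' [cii c'ii] j' /=.
  rewrite inE => /orP[/eqP ->|js]; first exact: c'P.
  exact: cP.
(* One row is chosen for each colour that occurs; these rows form the net. The error is [e / 3] in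
   the chosen column, plus [e / 3] twice for passing to and from it. *)
have /choice[h hP] (t : T) : exists o : option I,
    (exists2 i, o = Some i & c i = t) \/ forall i, c i <> t.
  have [[i ci]|nc] := pselect (exists i, c i = t).
    by exists (Some i); left; exists i.
  by exists None; right => i ci; apply: nc; exists i.
exists (Some @^-1` range h).
  apply: (@finite_preimage _ _ (range h) Some); first by move=> ? ? _ _ [].
  exact/finite_image/finite_finset.
move=> i; have [[i' hi' cii]|/(_ i)//] := hP (c i).
exists i' => [|j]; first by exists (c i).
have [j' Dj' jj'] := aD j.
have := cP _ _ cii _ Dj'; rewrite rnorm_distC => ii'.
have := ler_rnorm_distD (a i j') (a i j) (a i' j).
have := ler_rnorm_distD (a i' j') (a i j') (a i' j).
have := jj' i; have := jj' i'; rewrite (rnorm_distC (a i' j)).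
by move: ii'; lra.
Qed.

End complex_norm.

(** * Total boundedness versus compactness *)

Section total_boundedness_and_compactness.
Variable R : realType.
Local Notation C := (Cplx R).

Lemma compact_totally_bounded (V : normedModType C) (A : set V) :
  compact A -> totally_bounded A.
Proof.
rewrite compact_cover => cA e e0.
have [||D _ AD] := cA V setT (fun x => ball x e).
- by move=> x _; exact: ball_open.
- by move=> x _; exists x => //; exact: ballxx.
by exists [set` D]; [exact: finite_fset|exact: AD].
Qed.

Lemma precompact_totally_bounded (V : normedModType C) (A : set V) :
  precompact A -> totally_bounded A.
Proof.
rewrite precompactE => /compact_totally_bounded.
exact: totally_bounded_sub (@subset_closure _ A).
Qed.

Lemma totally_bounded_closure (V : normedModType C) (A : set V) :
  totally_bounded A -> totally_bounded (closure A).
Proof.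
move=> tbA e e0; have e20 : 0 < e / 2 by rewrite divr_gt0.
have [D fD AD] := tbA _ e20; exists D => // x clAx.
have [y [/AD[z Dz zy] xy]] := clAx _ (nbhsx_ballx x _ e20).
by exists z => //; exact: ball_splitl zy xy.
Qed.

(** Otherwise the ultrafilter contains all the complements, hence their finite intersection, which
    is disjoint from the union. *)
Lemma ultra_finite_cover (T : Type) (I : choiceType) (G : set_system T)
    (D : set I) (f : I -> set T) : UltraFilter G -> finite_set D ->
  G (\bigcup_(i in D) f i) -> exists2 i, D i & G (f i).
Proof.
move=> GU /finite_fsetP[X ->] GX; apply: contrapT => nG.
have GP := @ultra_proper _ _ GU.
have : G (\bigcap_(i in [set` X]) ~` f i).
  apply: filter_bigI => i iX; have [Gi|//] := in_ultra_setVsetC (f i) GU.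
  by exfalso; apply: nG; exists i.
rewrite -setC_bigcup => GC.
by have [x []] := filter_ex (filterI GX GC).
Qed.

(* An ultrafilter on a totally bounded set is Cauchy. *)
Lemma totally_bounded_precompact (V : completeNormedModType C) (A : set V) :
  totally_bounded A -> precompact A.
Proof.
move=> /totally_bounded_closure tbA.
rewrite precompactE compact_ultra => G GU GA.
have /cauchy_cvgP/cvg_ex[x Gx] : cauchy G.
  apply: cauchy_exP => e e0; have [D fD AD] := tbA _ e0.
  have [x _ Gx] := ultra_finite_cover GU fD (filterS AD GA).
  by exists x.
exists x; split => //; apply: closed_closure => U xU.
have GP := @ultra_proper _ _ GU.
exact: filter_ex (filterI GA (Gx _ xU)).
Qed.

End total_boundedness_and_compactness.

(** * Completeness of the complex numbers and of the space of continuous functions *)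

Section completeness.
Variables (R : realType) (Om : compactHausdorffType).
Local Notation C := (Cplx R).
Local Notation CO := (Cspace R Om).

(** Real and imaginary parts are 1-Lipschitz, so they carry a Cauchy filter to Cauchy filters on the
    complete field [R]; the two limits are then combined. *)
Lemma Cplx_cauchy_cvg (G : set_system C) :
  ProperFilter G -> cauchy G -> cvg G.
Proof.
move=> GF /cauchyP Gc; apply/cvg_ex.
have lim (p : C -> R) : (forall z w, `|p z - p w| <= rnorm (z - w)) ->
    exists l : R, p @ G --> l.
  move=> pd; suff /cauchy_cvgP/cvg_ex[l pl] : cauchy (p @ G) by exists l.
  apply: cauchy_exP => e e0.
  have [z Gz] := Gc _ (real_complex_gt0 e0); exists (p z).
  suff : G [set w | ball (p z) e (p w)] by [].
  apply: filterS Gz => w; rewrite ball_rnormE => zw.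
  exact: le_lt_trans (pd z w) zw.
have [|a Ga] := lim (fun z => complex.Re (z : R[i])).
  by move=> z w; rewrite (le_trans _ (Re_ge_rnorm _))//; case: z w => ? ? [].
have [|b Gb] := lim (fun z => complex.Im (z : R[i])).
  by move=> z w; rewrite (le_trans _ (Im_ge_rnorm _))//; case: z w => ? ? [].
exists (a +i* b : C); apply/fcvg_rnormP => e e0.
have e20 : 0 < e / 2 by rewrite divr_gt0.
move/cvgrPdist_lt/(_ _ e20) : Ga => Ga; move/cvgrPdist_lt/(_ _ e20) : Gb => Gb.
apply: filterS2 Ga Gb => z za zb; apply: le_lt_trans (rnorm_le_ReIm _) _.
by case: z za zb => c d /=; lra.
Qed.

Lemma rnorm_Cspace_le (f : CO) (M : R) :
  0 <= M -> (forall s, rnorm (f s) <= M) -> rnorm f <= M.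
Proof. by move=> M0 fM; rewrite rnorm_CspaceE supnorm_le. Qed.

(** Pointwise limits exist by completeness of [C]; the Cauchy condition makes the convergence
    uniform, and a uniform limit of continuous functions is continuous. *)
Lemma Cspace_cauchy_cvg (G : set_system CO) :
  ProperFilter G -> cauchy G -> cvg G.
Proof.
move=> GF /cauchyP Gc; apply/cvg_ex.
have /choice[g Gg] (s : Om) : exists l : C, (fun f : CO => f s : C) @ G --> l.
  apply/cvg_ex; apply: Cplx_cauchy_cvg; apply: cauchy_exP.
  move=> e /Cplx_gt0P[r r0 ->].
  have [f Gf] := Gc _ (real_complex_gt0 r0); exists (f s).
  suff : G [set h : CO | ball (f s : C) (r%:C : C) (h s)] by [].
  apply: filterS Gf => h; rewrite /= !ball_rnormE.
  exact: le_lt_trans (rnorm_Cspace_ge (f - h) s).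
(* A single [f] is close both to a member of the filter [G] and, at every point, to [g]: for each
   [s] some [h] is near [f] in norm and near [g] at [s]. *)
have approx e : 0 < e -> exists f : CO,
    G [set h | rnorm (f - h) < e] /\ forall s, rnorm (f s - g s) <= e + e.
  move=> e0; have [f Gf] := Gc _ (real_complex_gt0 e0); exists f.
  have {}Gf : G [set h | rnorm (f - h) < e].
    by apply: filterS Gf => h; rewrite ball_rnormE.
  split=> // s; have /cvg_rnormP-/(_ _ e0) Gs := Gg s.
  have [h /= [fh gh]] := filter_ex (filterI Gf Gs).
  apply: le_trans (ler_rnorm_distD (h s) _ _) _.
  have := rnorm_Cspace_ge (f - h) s; rewrite [rnorm (h s - _)]rnorm_distC.
  by move: fh gh => /=; lra.
have cg : continuous g.
  move=> s; apply/cvg_rnormP => e e0.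
  (* The path from [g s] to [g t] through [f s] and [f t] costs two fifths, one fifth and two fifths
     of [e]. *)
  have e50 : 0 < e / 5 by rewrite divr_gt0.
  have [f [_ fg]] := approx _ e50.
  have /cvg_rnormP/(_ _ e50) := @Cspace_continuous _ _ f s.
  apply: filterS => t /= ft; have := fg s; have := fg t.
  have := ler_rnorm_distD (f s) (g s) (g t).
  have := ler_rnorm_distD (f t) (f s) (g t).
  by rewrite [rnorm (g s - f s)]rnorm_distC; move: ft => /=; lra.
exists (MkCspace (mem_set cg)); apply/fcvg_rnormP => e e0.
have e40 : 0 < e / 4 by rewrite divr_gt0.
have [f [Gf fg]] := approx _ e40; apply: filterS Gf => h /= fh.
have : rnorm (f - MkCspace (mem_set cg)) <= e / 4 + e / 4.
  by apply: rnorm_Cspace_le => //; lra.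
have := ler_rnorm_distD f (MkCspace (mem_set cg)) h.
by rewrite (rnorm_distC f (MkCspace _)); lra.
Qed.

(** Needed for the convergence of the series [Lambda F b] and for precompactness of the image of the
    unit ball. *)
HB.instance Definition _ := Uniform_isComplete.Build CO Cspace_cauchy_cvg.

End completeness.

(** * Functionals in the dual unit ball *)

Section bounded_functionals.
Variables (R : realType) (V : normedModType (Cplx R)).
Local Notation C := (Cplx R).

Lemma dual_ball_le (phi : {scalar V}) (x : V) :
  dual_ball phi -> rnorm (phi x : C) <= rnorm x.
Proof.
move=> [cphi phi1].
have phiZ (r : R) y : 0 <= r ->
    rnorm (phi ((r%:C : C) *: y) : C) = r * rnorm (phi y : C).
  move=> r0; rewrite linearZ /= -[X in _ = X * _](ger0_norm r0) -(rnorm_real r).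
  exact: (rnormZ (V := C)).
have [d d0 phid] : exists2 d : R, 0 < d &
    forall y, rnorm y < d -> rnorm (phi y : C) < 1.
  have /cvg_rnormP/(_ _ ltr01)/nbhs_rnormP[d d0 dP] := cphi 0.
  exists d => // y yd; have := dP y; rewrite sub0r rnormN => /(_ yd).
  by rewrite /= linear0 sub0r rnormN.
(* [sup] is 0 on a nonempty set without upper bound, so a bound must come first: since [phi] stays
   below 1 on the ball of radius [d], homogeneity bounds it by [2 / d] on the unit ball. *)
have phi_ub : has_ubound
    [set rnorm (phi y : C) | y in [set y : V | rnorm y <= 1]].
  have d20 : 0 < d / 2 by rewrite divr_gt0.
  exists (d / 2)^-1 => _ [y /= y1 <-].
  rewrite -[leRHS]mul1r ler_pdivlMr// mulrC -phiZ; last exact: ltW.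
  apply/ltW/phid; rewrite rnormZ rnorm_real ger0_norm ?(ltW d20)//.
  by rewrite (@le_lt_trans _ _ (d / 2))//; [rewrite ler_piMr// ltW|lra].
have [x0|x0] := eqVneq (rnorm x) 0.
  by rewrite (rnorm0_eq0 x0) linear0 !rnorm0.
have {}x0 : 0 < rnorm x by rewrite lt_neqAle eq_sym x0 rnorm_ge0.
rewrite -[leRHS]mul1r -ler_pdivrMr// mulrC -phiZ ?invr_ge0 ?(ltW x0)//.
apply: le_trans phi1; apply: ub_le_sup => //=.
exists (((rnorm x)^-1)%:C *: x) => //=.
by rewrite rnormZ rnorm_real ger0_norm ?invr_ge0 ?(ltW x0)// mulVf ?gt_eqF.
Qed.

End bounded_functionals.

(** * Point evaluations *)

Section evaluation.
Variables (R : realType) (Om : compactHausdorffType).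
Local Notation C := (Cplx R).
Local Notation CO := (Cspace R Om).

(** A named function, so that a linear structure can be attached to it. *)
Definition eval_at (s : Om) (f : CO) : C := f s.

Fact eval_at_is_scalar s : scalar (eval_at s).
Proof. by []. Qed.

HB.instance Definition _ s :=
  GRing.isLinear.Build C CO C _ (eval_at s) (eval_at_is_scalar s).

Lemma eval_at_continuous s : continuous (eval_at s).
Proof.
apply: contraction_continuous => f g; exact: (rnorm_Cspace_ge (f - g) s).
Qed.

Lemma eval_at_dual_ball s : dual_ball (eval_at s : {scalar CO}).
Proof.
split; first exact: eval_at_continuous.
apply: ge_sup; first by exists (rnorm (eval_at s 0)), 0 => //=; rewrite rnorm0.
by move=> _ [f /= f1 <-]; apply: le_trans f1; exact: rnorm_Cspace_ge.
Qed.

End evaluation.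

(** * The operator from summable sequences to continuous functions *)

Section Lambda.
Variables (R : realType) (Om : compactHausdorffType).
Local Notation C := (Cplx R).
Local Notation CO := (Cspace R Om).
Variable F : linfty CO.

(** Cauchy criterion: a block of the series has norm at most [rnorm F + 1] times the same block of
    the series of [rnorm (b i)]. The added 1 keeps the divisor positive when [F] is zero. *)
Lemma cvg_Lambda (b : lone R) :
  series (fun i => b i *: F i) @ \oo --> Lambda F b.
Proof.
apply/cauchy_cvgP/cauchy_seriesP => e /Cplx_gt0P[r r0 ->].
have M0 : 0 < rnorm F + 1 by rewrite ltr_wpDl ?rnorm_ge0.
have /cauchy_cvgP/cauchy_seriesP/(_ (r / (rnorm F + 1))) := @lone_summable _ b.
rewrite divr_gt0// => /(_ isT); apply: filterS => -[m n] /=.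
rewrite rnormE ltcR ltr_pdivlMr// => /(le_lt_trans _)->//.
apply: le_trans (ler_rnorm_sum _ _ _) _.
apply: (@le_trans _ _ ((\sum_(m <= i < n) rnorm (b i)) * (rnorm F + 1))).
  rewrite mulr_suml; apply: ler_sum => i _; rewrite rnormZ.
  rewrite ler_wpM2l ?rnorm_ge0// (le_trans (rnorm_linfty_ge F i))// lerDl//.
by rewrite ler_wpM2r ?(ltW M0)// ler_norm.
Qed.

Lemma linear_Lambda : linear (Lambda F).
Proof.
move=> a u v; apply: (@cvg_lim CO) => //.
have -> : series (fun i => (a *: u + v) i *: F i) =
    a *: series (fun i => u i *: F i) + series (fun i => v i *: F i).
  apply/funext => n; rewrite /series /= [RHS](_ : _ =
    a *: (\sum_(0 <= k < n) u k *: F k) + \sum_(0 <= k < n) v k *: F k)//.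
  rewrite scaler_sumr -big_split /=.
  by apply: eq_bigr => i _; rewrite scalerA -scalerDl.
apply: cvgD; last exact: cvg_Lambda.
apply: cvgZl_tmp; exact: cvg_Lambda.
Qed.

(** The bound holds for partial sums by linearity and passes to the limit by continuity of [phi].
    Stated for functionals so that it covers both point evaluations and their differences. *)
Lemma rnorm_Lambda_le (phi : {scalar CO}) (b : lone R) (M : R) :
  continuous phi -> (forall i, rnorm (phi (F i) : C) <= M) ->
  rnorm (phi (Lambda F b) : C) <= M * rnorm b.
Proof.
move=> cphi phiM.
have M0 : 0 <= M := le_trans (rnorm_ge0 _) (phiM 0%N).
apply/ler_addgt0Pr => e e0.
have /cvg_rnormP/(_ _ e0)[n _ /(_ n (leqnn n))] :
  phi \o series (fun i => b i *: F i) @ \oo --> (phi (Lambda F b) : C).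
  exact: cvg_comp (cvg_Lambda (b := b)) (cphi _).
set S := series _ => /= nS.
have -> : phi (Lambda F b) = phi (S n) + (phi (Lambda F b) - phi (S n)) :> C.
  by rewrite addrC subrK.
apply: le_trans (ler_rnormD _ _) _; apply: lerD; last exact: ltW.
rewrite /S /series /= linear_sum; apply: le_trans (ler_rnorm_sum _ _ _) _.
apply: le_trans (_ : \sum_(0 <= i < n) M * rnorm (b i) <= _); last first.
  by rewrite -mulr_sumr ler_wpM2l// sum_rnorm_lone_le.
apply: ler_sum => i _; rewrite linearZ.
apply: le_trans (_ : rnorm (b i) * rnorm (phi (F i) : C) <= _).
  by rewrite -(rnormZ (V := C)).
by rewrite mulrC ler_wpM2r ?rnorm_ge0.
Qed.

End Lambda.

(** * The implications between the five conditions *)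

Section equivalences.
Variables (R : realType) (Om : compactHausdorffType) (F : linfty (Cspace R Om)).
Local Notation C := (Cplx R).
Local Notation CO := (Cspace R Om).

Lemma rnorm_eval_seqB_ge s t i :
  rnorm (F i s - F i t) <= rnorm (eval_seq F s - eval_seq F t).
Proof. exact: (rnorm_linfty_ge (eval_seq F s - eval_seq F t) i). Qed.

(** Transposition with indices as rows and points as columns: the column at [s] is the sequence
    [eval_seq F s]. *)
Lemma totally_bounded_range_of_eval_seq :
  totally_bounded (range (eval_seq F)) ->
  totally_bounded (range (F : nat -> CO)).
Proof.
move=> /totally_bounded_rangeP tb; apply/totally_bounded_rangeP => e e0.
have [|d d0|D fD FD] := @finite_net_transpose R nat Om
  (fun i s => F i s) (rnorm F) _ _ e e0.
- move=> i s; apply: le_trans (rnorm_Cspace_ge _ _) _; exact: rnorm_linfty_ge.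
- have [D fD FD] := tb _ d0; exists D => // s; have [t Dt st] := FD s.
  by exists t => // i; apply: le_trans st; exact: rnorm_eval_seqB_ge.
- exists D => // i; have [j Dj ij] := FD i; exists j => //.
  by apply: rnorm_Cspace_le => //; exact: ltW.
Qed.

(** Transposition with functionals as rows and indices as columns; a functional of norm at most 1
    does not increase the distance between [F i] and [F j]. *)
Lemma linfty_c_of_totally_bounded :
  totally_bounded (range (F : nat -> CO)) -> linfty_c (F : nat -> CO).
Proof.
move=> /totally_bounded_rangeP tb.
have phiF (phi : {scalar CO}) i :
    dual_ball phi -> rnorm (phi (F i) : C) <= rnorm F.
  by move=> /(dual_ball_le (F i))/le_trans; apply; exact: rnorm_linfty_ge.
have bphi phi : dual_ball phi -> bounded_fun (fun i => phi (F i) : C).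
  by move=> phi1; apply/bounded_funPr; exists (rnorm F) => i; exact: phiF.
split=> //.
(* Indexing by a subtype presents the set of sequences as a range. *)
pose g (phi : {phi : {scalar CO} | dual_ball phi}) : linfty C :=
  MkLinfty (mem_set (bphi _ (svalP phi))).
apply: (@totally_bounded_sub _ _ _ (range g)).
  move=> x [phi phi1 xphi]; exists (exist _ phi phi1) => //.
  by apply/val_inj/funext => i; rewrite /= xphi.
apply/totally_bounded_rangeP => e e0.
have [|d d0|D fD FD] := @finite_net_transpose R _ nat
  (fun (phi : {phi : {scalar CO} | dual_ball phi}) i => sval phi (F i) : C)
  (rnorm F) _ _ e e0.
- by move=> [phi phi1] i; exact: phiF.
- have [D fD FD] := tb _ d0; exists D => // i; have [j Dj ij] := FD i.
  exists j => // -[phi phi1] /=; apply: le_trans ij.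
  by rewrite -linearB; exact: dual_ball_le.
- exists D => // phi; have [psi Dpsi phipsi] := FD phi; exists psi => //.
  by apply: rnorm_linfty_le => //; exact: ltW.
Qed.

Lemma totally_bounded_eval_seq_of_linfty_c :
  linfty_c (F : nat -> CO) -> totally_bounded (range (eval_seq F)).
Proof.
move=> [_]; apply: totally_bounded_sub => _ [s _ <-].
by exists (eval_at s : {scalar CO}); first exact: eval_at_dual_ball.
Qed.

(** Transposition with vectors of the unit ball as rows and points as columns, followed by
    completeness to pass from totally bounded to precompact. *)
Lemma compact_Lambda_of_eval_seq :
  totally_bounded (range (eval_seq F)) -> compact_operator (Lambda F).
Proof.
move=> /totally_bounded_rangeP tb; split; first exact: linear_Lambda.
apply: totally_bounded_precompact.
pose g (b : {b : lone R | rnorm b <= 1}) : CO := Lambda F (sval b).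
apply: (@totally_bounded_sub _ _ _ (range g)).
  by move=> _ [b /= + <-]; rewrite (rnorm_leP b 1) => b1; exists (exist _ b b1).
have gM (phi : {scalar CO}) (M : R) : continuous phi ->
    (forall i, rnorm (phi (F i) : C) <= M) ->
    forall b, rnorm (phi (g b) : C) <= M.
  move=> cphi phiM [b b1]; apply: le_trans (rnorm_Lambda_le b cphi phiM) _.
  by rewrite ler_piMr// (le_trans _ (phiM 0%N))// rnorm_ge0.
apply/totally_bounded_rangeP => e e0.
have [|d d0|D fD FD] := @finite_net_transpose R _ Om
  (fun b s => g b s) (rnorm F) _ _ e e0.
- move=> b s; apply: (gM (eval_at s)); first exact: eval_at_continuous.
  by move=> i; apply: le_trans (rnorm_Cspace_ge _ _) _; exact: rnorm_linfty_ge.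
- have [D fD FD] := tb _ d0; exists D => // s; have [t Dt st] := FD s.
  (* The difference of the evaluations at [s] and [t] is a continuous functional, bounded on every
     [F i] by the distance from [eval_seq F s] to [eval_seq F t]; the bound then passes to [g b]. *)
  exists t => // b; apply: (gM (eval_at s \- eval_at t)).
    move=> f; exact: (@cvgB C C) (@eval_at_continuous _ _ s f)
      (@eval_at_continuous _ _ t f).
  by move=> i; apply: le_trans st; exact: rnorm_eval_seqB_ge.
- exists D => // b; have [c Dc bc] := FD b; exists c => //.
  by apply: rnorm_Cspace_le => //; exact: ltW.
Qed.

Lemma totally_bounded_range_of_compact_Lambda :
  compact_operator (Lambda F) -> totally_bounded (range (F : nat -> CO)).
Proof.
move=> [_ /precompact_totally_bounded]; apply: totally_bounded_sub.
(* [d] is the [i]-th unit vector; it has norm 1 and its image is [F i]. *)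
move=> _ [i _ <-]; pose d (j : nat) : C := (j == i)%:R.
have sd : series (fun j => rnorm (d j)) @ \oo --> (1 : R).
  apply: cvg_near_cst; exists i.+1 => // n /= ni; rewrite seriesEnat /=.
  rewrite (bigD1_seq i) ?iota_uniq ?mem_index_iota//= big1 => [|j /negbTE ji].
    by rewrite /d eqxx addr0 (rnorm_real (1 : R)) normr1.
  by rewrite /d ji rnorm0.
have dP : d \in @summable_pred R by rewrite inE /=; apply/cvg_ex; exists 1.
exists (MkLone dP : lone R).
  by rewrite /= (rnorm_leP (MkLone dP) 1) /rnorm /= (cvg_lim _ sd).
apply: (@cvg_lim CO) => //; apply: cvg_near_cst; exact: (sum_delta F i).
Qed.

Lemma continuous_eval_seq_of_totally_bounded :
  totally_bounded (range (F : nat -> CO)) -> continuous (eval_seq F).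
Proof.
move=> /totally_bounded_rangeP tb s; apply/cvg_rnormP => e e0.
have e40 : 0 < e / 4 by rewrite divr_gt0.
have [D fD FD] := tb _ e40; move/finite_fsetP : fD => [X DX].
have : nbhs s (\bigcap_(j in [set` X]) [set t | rnorm (F j s - F j t) < e / 4]).
  apply: filter_bigI => j _.
  by have /cvg_rnormP/(_ _ e40) := @Cspace_continuous _ _ (F j) s.
apply: filterS => t st.
(* A supremum only inherits a weak inequality, so the coordinates are bounded by three quarters of
   [e]. *)
apply: (@le_lt_trans _ _ (e / 4 + e / 4 + e / 4)); last by lra.
apply: rnorm_linfty_le => [|i]; first by lra.
have [j + ij] := FD i; rewrite DX => /st /= jst.
have := ler_rnorm_distD (F j s) (F i s : C) (F i t).
have := ler_rnorm_distD (F j t) (F j s : C) (F i t).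
have := le_trans (rnorm_Cspace_ge (F i - F j) s) ij.
have := le_trans (rnorm_Cspace_ge (F i - F j) t) ij.
rewrite [rnorm (F j t - F i t)]rnorm_distC.
rewrite /eval_seq /=; move: jst; lra.
Qed.

Lemma totally_bounded_eval_seq_of_continuous :
  continuous (eval_seq F) -> totally_bounded (range (eval_seq F)).
Proof.
move=> cF; apply: compact_totally_bounded; apply: continuous_compact compactT.
exact: continuous_subspaceT.
Qed.

End equivalences.

Theorem theorem4p3 (R : realType) (Omega : compactHausdorffType)
    (F : linfty (Cspace R Omega)) :
  [<-> totally_bounded (range (eval_seq F));
       linfty_c (F : nat -> Cspace R Omega);
       compact_operator (Lambda F);
       totally_bounded (range (F : nat -> Cspace R Omega));
       continuous (eval_seq F)].
Proof.
tfae.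
(* The cycle follows the listed order: (1) gives (2) by way of (4), and (2) gives (3) by way of
   (1). *)
- move=> /totally_bounded_range_of_eval_seq; exact: linfty_c_of_totally_bounded.
- move=> /totally_bounded_eval_seq_of_linfty_c; exact: compact_Lambda_of_eval_seq.
- exact: totally_bounded_range_of_compact_Lambda.
- exact: continuous_eval_seq_of_totally_bounded.
- exact: totally_bounded_eval_seq_of_continuous.
Qed.
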